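(* Let $G$ be an arbitrary graph without isolated vertices and let $\tilde G$ be its suspension. Then $$1\le\nu(\tilde G)\le\nu(G)+1.$$ In particular, for every tree $T$ with at least two vertices, its suspension $\tilde T$ satisfies $$\nu(\tilde T)=1.$$
   Context: All graphs $G=(V,E)$ are finite and simple with nonempty vertex set; $x\sim y$ denotes adjacency. $E^{or}(G)$ is the set of ordered pairs $(x,y)$ with $x\sim y$. A magnetic potential is a map $\sigma:E^{or}(G)\to S^1=\{z\in\mathbb{C}:|z|=1\}$ with $\sigma(y,x)=\sigma(x,y)^{-1}$. The magnetic Laplacian on functions $f:V\to\mathbb{C}$ is $\Delta^\sigma f(x)=\sum_{y\sim x}(f(x)-\sigma(x,y)f(y))$, and $\lambda_1^\sigma(G)$ is its smallest eigenvalue. The magneto-spectral height is $\nu(G)=\sup_\sigma\lambda_1^\sigma(G)$, over all magnetic potentials $\sigma$ on $G$. The suspension $\tilde G$ of $G$ is obtained from $G$ by adding one new vertex and connecting it to all vertices of $G$. *)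

(* Defs.v *)
From HB Require Import structures.
From mathcomp Require Import all_boot all_order all_algebra.
From mathcomp Require Import complex.
From mathcomp Require Import boolp classical_sets reals.

Set Implicit Arguments.
Unset Strict Implicit.
Unset Printing Implicit Defensive.

Import Order.TTheory GRing.Theory Num.Theory.
Local Open Scope ring_scope.
Local Open Scope complex_scope.

Record sgraph := SGraph {
  vertex :> finType;
  adj : rel vertex;
  adj_sym : symmetric adj;
  adj_irrefl : irreflexive adj;
  vertex_gt0 : (0 < #|vertex|)%N
}.

Definition no_isolated (G : sgraph) : Prop :=
  forall x : G, exists y : G, adj x y.

(* A simple cycle has at least 3 vertices; [ucycle] alone also accepts the
   empty sequence and [:: x; y] for an edge xy. *)
Definition acyclic (G : sgraph) : Prop :=
  forall c : seq G, (2 < size c)%N -> ~ ucycle (@adj G) c.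

Definition is_tree (G : sgraph) : Prop :=
  (forall x y : G, connect (@adj G) x y) /\ acyclic G.

Section Suspension.
Variable G : sgraph.

Definition susp_adj (x y : option G) : bool :=
  match x, y with
  | Some u, Some v => adj u v
  | None, None => false
  | _, _ => true
  end.

Lemma susp_adj_sym : symmetric susp_adj.
Proof. by case=> [x|] [y|] //=; apply: adj_sym. Qed.

Lemma susp_adj_irrefl : irreflexive susp_adj.
Proof. by case=> [x|] //=; apply: adj_irrefl. Qed.

Lemma susp_vertex_gt0 : (0 < #|{: option G}|)%N.
Proof. by rewrite card_option. Qed.

(* The vertex added to G is [None]. *)
Definition suspension : sgraph :=
  SGraph susp_adj_sym susp_adj_irrefl susp_vertex_gt0.

End Suspension.

Section MagneticLaplacian.
Variables (R : realType) (G : sgraph).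

(* Only the values of s on ordered pairs of adjacent vertices are constrained,
   and only these enter the Laplacian. *)
Definition magnetic_potential (s : G -> G -> R[i]) : Prop :=
  forall x y : G, adj x y -> `|s x y| = 1 /\ s y x = (s x y)^-1.

Definition mag_laplacian (s : G -> G -> R[i]) (f : {ffun G -> R[i]^o}) :
    {ffun G -> R[i]^o} :=
  [ffun x => \sum_(y | adj x y) (f x - s x y * f y)].

Lemma mag_laplacian_linear s : linear (mag_laplacian s).
Proof.
move=> a f g; apply/ffunP=> x; rewrite !ffunE scaler_sumr -big_split /=.
apply: eq_bigr => y _; rewrite !ffunE /GRing.scale /=.
by rewrite mulrBr mulrDr (mulrCA (s x y)) opprD addrACA.
Qed.

HB.instance Definition _ s :=
  GRing.isLinear.Build R[i] {ffun G -> R[i]^o} {ffun G -> R[i]^o} _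
    (mag_laplacian s) (mag_laplacian_linear s).

Definition mag_eigenvalue (s : G -> G -> R[i]) (a : R[i]) : bool :=
  passmx.leigenvalue (linfun (mag_laplacian s)) a.

Lemma mag_eigenvalueP s a :
  reflect (exists2 f, f != 0 & mag_laplacian s f = a *: f) (mag_eigenvalue s a).
Proof.
rewrite /mag_eigenvalue /passmx.leigenvalue /passmx.leigenspace.
have E f : (f \in lker (linfun (mag_laplacian s) - a *: \1%VF)) =
           (mag_laplacian s f == a *: f).
  by rewrite memv_ker add_lfunE opp_lfunE scale_lfunE id_lfunE lfunE /= subr_eq0.
apply: (iffP idP) => [nz|[f f0 fE]].
  exists (vpick (lker (linfun (mag_laplacian s) - a *: \1%VF))).
    by rewrite vpick0.
  by apply/eqP; rewrite -E memv_pick.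
apply: contraNneq f0 => L0; rewrite -memv0 -L0 E; exact/eqP.
Qed.

(* On R[i] the relation [r%:C <= a] means that a is real and at least r, so
   this also asserts that the spectrum is real, as it is when s is a magnetic
   potential, the Laplacian being Hermitian. *)
Definition is_lambda1 (s : G -> G -> R[i]) (r : R) : Prop :=
  mag_eigenvalue s r%:C /\ forall a, mag_eigenvalue s a -> r%:C <= a.

Definition nu : R :=
  sup [set r : R | exists2 s, magnetic_potential s & is_lambda1 s r]%classic.

End MagneticLaplacian.

(* Main.v *)
Require Import Defs.
From mathcomp Require Import boolp classical_sets.
From mathcomp Require Import all_boot all_order all_algebra.
From mathcomp Require Import complex reals ring.

(** The Laplacian of a magnetic potential is Hermitian, and twice its quadratic
    form is the energy, the sum over ordered pairs of adjacent vertices of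
    |f x - s x y * f y|^2.  By the spectral theorem [lambda_1] exists and is the
    minimum of the Rayleigh quotient; [le_nu], [nu_le] and [energy_le_nu]
    express this for [nu], and everything else is about energies.

    Upper bound: restrict a potential of the suspension to [G] and extend a
    minimiser on [G] by 0 at the hub.  Each vertex of [G] then contributes one
    extra edge, to the hub, of energy |f x|^2, so the Rayleigh quotient grows
    by exactly 1 ([nu_suspension_le]).

    Lower bound: a graph without isolated vertices is covered by disjoint stars
    with at least two vertices each ([star_forest]).  Give the edges of [G] the
    value 1 and the edge from the hub to [x] a unit number w x such that the
    sum of [w] over each star vanishes, e.g. the powers of a root of unity
    ([unit_sum0]).  Keep only the star edges and the hub edges, let h be the
    value of [f] at the hub and c x the centre of the star of x.  For a leaf x,
    completing the square in f x gives
      |h - w x * f x|^2 + |f (c x) - f x|^2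
        >= |f x|^2 - 2 Re (conj (w x) * h * conj (f (c x))),
    and for a centre the left-hand side is equal to the right-hand side plus
    |h|^2.  Summed over a star, the real parts cancel because the sum of [w]
    is 0.  So the form is at least the sum of all |f x|^2 plus |h|^2 for every
    star, of which there is at least one ([one_le_nu_suspension]).

    Trees: every potential on a tree is gauge equivalent to the trivial one, so
    there is a nowhere vanishing function of zero energy ([tree_gauge]) and
    nu T <= 0; the two bounds then meet at 1. *)

Set Implicit Arguments.
Unset Strict Implicit.
Unset Printing Implicit Defensive.
Import Order.TTheory GRing.Theory Num.Theory.
Local Open Scope ring_scope.
Local Open Scope sesquilinear_scope.

(** * Hermitian matrices *)

(** In an orthonormal eigenbasis the form is a combination of the real
    eigenvalues with the weights |z_i|^2, so the least eigenvalue bounds it from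
    below; having both facts about the same [r] is what characterises
    [lambda_1]. *)
Lemma hermitian_min_eigenvalue (R : rcfType) (n : nat) (A : 'M[R[i]]_n) :
  (0 < n)%N -> A \is hermsymmx ->
  exists r : R,
    (exists2 v : 'rV_n, v != 0 & v *m A = (r%:C)%C *: v) /\
    forall w : 'rV_n, (r%:C)%C * (w *m w^t*) 0 0 <= (w *m A *m w^t*) 0 0.
Proof.
move=> n_gt0 Aherm.
have /hermitian_normalmx/orthomx_spectralP := Aherm.
have /mxOverP := hermitian_spectral_diag_real Aherm.
set P := spectralmx A; set d := spectral_diag A => d_real A_eq.
have Pu : P \is unitarymx := spectral_unitarymx A.
have Punit := unitarymx_unit Pu.
have dE i : d 0 i = ((complex.Re (d 0 i))%:C)%C.
  by rewrite RRe_real // d_real.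
case: (@arg_minP _ _ _ (Ordinal n_gt0) predT
  (fun i => complex.Re (d 0 i))) => //.
move=> k _ kmin; exists (complex.Re (d 0 k)); split.
  exists (row k P).
    apply/eqP => rowP0; have := row_unitarymxP Pu k k.
    by rewrite dotmxE rowP0 mul0mx mxE eqxx => /esym/eqP; rewrite oner_eq0.
  by rewrite -dE {1}A_eq !mulmxA -row_mul mulmxV // -row_mul mul1mx row_diag_mx
    -scalemxAl -rowE.
move=> w; set z := w *m P^t*.
have wwE : w *m w^t* = z *m z^t*.
  by rewrite /z trmx_mul map_mxM /= trmxCK mulmxA mulmxKtV.
have wAwE : w *m A *m w^t* = z *m diag_mx d *m z^t*.
  by rewrite {1}A_eq invmx_unitary // /z trmx_mul map_mxM /= trmxCK !mulmxA.
rewrite wwE wAwE mul_mx_diag !mxE mulr_sumr; apply: ler_sum => i _.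
rewrite !mxE (dE i) mulrAC -normCK [leRHS]mulrC.
by rewrite ler_wpM2r ?exprn_ge0 // lecR kmin.
Qed.

(** * Energy and the smallest eigenvalue *)

Section Energy.
Variables (R : realType) (G : sgraph).
Implicit Types (s : G -> G -> R[i]) (f : G -> R[i]).

Definition sqnorm f : R[i] := \sum_x `|f x| ^+ 2.

(** Every edge is counted once in each direction, hence the recurring factor
    2 ([*+ 2]) in the comparisons with [sqnorm]. *)
Definition energy s f : R[i] :=
  \sum_x \sum_(y | adj x y) `|f x - s x y * f y| ^+ 2.

Lemma potential_conj s x y :
  magnetic_potential s -> adj x y -> s y x = (s x y)^*.
Proof.
by move=> sP /sP[norm_s ->]; rewrite invC_norm norm_s expr1n invr1 mul1r.
Qed.

Lemma sqnorm_gt0 f x : f x != 0 -> 0 < sqnorm f.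
Proof.
move=> fx0; rewrite /sqnorm (bigD1 x) //= ltr_pwDl ?exprn_gt0 ?normr_gt0 //.
by apply: sumr_ge0 => y _; rewrite exprn_ge0.
Qed.

(** Green's formula: the contributions of (x, y) and (y, x) to the left-hand
    side add up to a perfect square, because [s y x] is the conjugate of
    [s x y]. *)
Lemma laplacian_energy s (f : {ffun G -> R[i]^o}) :
  magnetic_potential s ->
  (\sum_x mag_laplacian s f x * (f x)^*) *+ 2 = energy s f.
Proof.
move=> sP; pose q x y : R[i] := (f x - s x y * f y) * (f x)^*.
have lapE : \sum_x mag_laplacian s f x * (f x)^* =
    \sum_x \sum_(y | adj x y) q x y.
  by apply: eq_bigr => x _; rewrite ffunE mulr_suml.
have lapE' : \sum_x mag_laplacian s f x * (f x)^* =
    \sum_x \sum_(y | adj x y) q y x.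
  rewrite lapE (exchange_big_dep predT) //=; apply: eq_bigr => x _.
  by apply: eq_bigl => y; rewrite adj_sym.
rewrite mulr2n {1}lapE lapE' -big_split; apply: eq_bigr => x _.
rewrite -big_split; apply: eq_bigr => y xy; rewrite /q /=.
rewrite (potential_conj sP xy) normCK rmorphB rmorphM /=.
have ss : s x y * (s x y)^* = 1 by rewrite -normCK (sP _ _ xy).1 expr1n.
set a : R[i] := f x; set b : R[i] := f y.
transitivity (a * a^* + 1 * (b * b^*) - s x y * b * a^* - (s x y)^* * b^* * a).
  by ring.
by rewrite -{1}ss; ring.
Qed.

Definition row_of_fun f : 'rV[R[i]]_#|G| := \row_i f (enum_val i).

(** Vectors are rows acted upon from the right, so the entry (i, j) is the
    coefficient of the value at vertex i in the Laplacian at vertex j. *)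
Definition laplacian_mx s : 'M[R[i]]_#|G| :=
  \matrix_(i, j) ((i == j)%:R * (\sum_(y | adj (enum_val j) y) 1)
     - (adj (enum_val j) (enum_val i))%:R * s (enum_val j) (enum_val i)).

Lemma laplacian_mx_hermitian s :
  magnetic_potential s -> laplacian_mx s \is hermsymmx.
Proof.
move=> sP; apply/is_hermitianmxP; rewrite expr0 scale1r; apply/matrixP=> i j.
rewrite !mxE rmorphB !rmorphM rmorph_sum !rmorph_nat /=; congr (_ - _).
  rewrite eq_sym; case: eqP => [->|_]; last by rewrite !mul0r.
  by congr (_ * _); apply: eq_bigr => y _; rewrite rmorph1.
rewrite adj_sym; case: (boolP (adj _ _)) => [ij|_]; last by rewrite !mul0r.
by rewrite !mul1r (potential_conj sP ij).
Qed.

Lemma row_of_laplacian s (f : {ffun G -> R[i]^o}) :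
  row_of_fun (mag_laplacian s f) = row_of_fun f *m laplacian_mx s.
Proof.
apply/rowP=> j; rewrite !mxE ffunE; set x := enum_val j.
under [RHS]eq_bigr => i _ do rewrite !mxE mulrBr.
rewrite !sumrB; congr (_ - _).
  rewrite [RHS](bigD1 j) //= [X in _ + X]big1 => [|i ij]; last first.
    by rewrite (negPf ij) mul0r mulr0.
  rewrite addr0 eqxx mul1r mulr_sumr.
  by under [RHS]eq_bigr do rewrite mulr1.
rewrite (reindex (@enum_val G G)) /=; last first.
  by exists (@enum_rank G) => ? _; rewrite ?enum_valK ?enum_rankK.
rewrite big_mkcond; apply: eq_bigr => i _.
by case: ifP; rewrite ?mul0r ?mulr0 ?mul1r // mulrC.
Qed.

Lemma row_of_fun_norm f : (row_of_fun f *m (row_of_fun f)^t*) 0 0 = sqnorm f.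
Proof.
rewrite mxE /sqnorm (reindex (@enum_val G G)) /=; last first.
  by exists (@enum_rank G) => ? _; rewrite ?enum_valK ?enum_rankK.
by apply: eq_bigr => i _; rewrite !mxE normCK.
Qed.

Lemma row_of_fun_energy s f : magnetic_potential s ->
  (row_of_fun f *m laplacian_mx s *m (row_of_fun f)^t*) 0 0 *+ 2 = energy s f.
Proof.
move=> sP; pose g : {ffun G -> R[i]^o} := [ffun x => f x].
have gE x : g x = f x by rewrite ffunE.
have rgE : row_of_fun g = row_of_fun f by apply/rowP=> i; rewrite !mxE gE.
have <- : energy s g = energy s f.
  by apply: eq_bigr => x _; apply: eq_bigr => y _; rewrite !gE.
rewrite -laplacian_energy // -rgE -row_of_laplacian mxE; congr (_ *+ 2).
rewrite [RHS](reindex (@enum_val G G)) /=; last first.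
  by exists (@enum_rank G) => ? _; rewrite ?enum_valK ?enum_rankK.
by apply: eq_bigr => i _; rewrite !mxE.
Qed.

Lemma eigenfunction_energy s a (f : {ffun G -> R[i]^o}) :
  magnetic_potential s -> mag_laplacian s f = a *: f ->
  energy s f = a * sqnorm f *+ 2.
Proof.
move=> sP fE; rewrite -laplacian_energy // fE; congr (_ *+ 2).
by rewrite mulr_sumr; apply: eq_bigr => x _; rewrite ffunE -mulrA normCK.
Qed.

Lemma ffun_neq0_sqnorm (f : {ffun G -> R[i]^o}) : f != 0 -> 0 < sqnorm f.
Proof.
move=> f0; have [x fx0|f_eq0] := pickP (fun x => f x != 0).
  exact: sqnorm_gt0 fx0.
by case/eqP: f0; apply/ffunP=> x; rewrite ffunE; apply/eqP/negbFE/f_eq0.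
Qed.

Lemma exists_lambda1 s : magnetic_potential s ->
  exists2 r : R, is_lambda1 s r &
    forall f, (r%:C)%C * sqnorm f *+ 2 <= energy s f.
Proof.
move=> sP.
have [r [[v v0 vE] rmin]] := hermitian_min_eigenvalue (vertex_gt0 G)
  (laplacian_mx_hermitian sP).
have rmin_energy f : (r%:C)%C * sqnorm f *+ 2 <= energy s f.
  by rewrite -row_of_fun_energy // -row_of_fun_norm lerMn2r rmin.
exists r => //; split; last first.
  move=> a /mag_eigenvalueP[f /ffun_neq0_sqnorm f0 fE].
  have := rmin_energy f.
  by rewrite (eigenfunction_energy sP fE) lerMn2r /= ler_pM2r.
pose f : {ffun G -> R[i]^o} := [ffun x => v 0 (enum_rank x)].
have fvE : row_of_fun f = v.
  by apply/rowP=> i; rewrite mxE ffunE enum_valK.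
apply/mag_eigenvalueP; exists f.
  apply: contraNneq v0 => f0; rewrite -fvE f0.
  by apply/eqP/rowP=> i; rewrite !mxE ffunE.
apply/ffunP=> x; rewrite ffunE.
have /rowP/(_ (enum_rank x)) : row_of_fun (mag_laplacian s f) = (r%:C)%C *: v.
  by rewrite row_of_laplacian fvE.
by rewrite !mxE enum_rankK ffunE => ->; rewrite [RHS]ffunE ffunE.
Qed.

Lemma lambda1_le_energy s r f : magnetic_potential s -> is_lambda1 s r ->
  (r%:C)%C * sqnorm f *+ 2 <= energy s f.
Proof.
move=> sP [r_eig r_min]; have [r' [r'_eig r'_min] r'P] := exists_lambda1 sP.
have le_r : r <= r' by rewrite -lecR; apply: r_min.
apply: le_trans (r'P f); rewrite lerMn2r /= ler_wpM2r ?lecR //.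
by apply: sumr_ge0 => x _; rewrite exprn_ge0.
Qed.

Lemma lambda1_attained s r : magnetic_potential s -> is_lambda1 s r ->
  exists2 f, 0 < sqnorm f & energy s f = (r%:C)%C * sqnorm f *+ 2.
Proof.
move=> sP [/mag_eigenvalueP[f /ffun_neq0_sqnorm f0 fE] _].
by exists f => //; apply: eigenfunction_energy.
Qed.

Local Notation lambda1s :=
  [set r : R | exists2 s, magnetic_potential s
                        & is_lambda1 (G := G) s r]%classic.

Lemma trivial_potential : magnetic_potential (G := G) (fun _ _ => 1 : R[i]).
Proof. by move=> x y _; rewrite normr1 invr1. Qed.

Lemma lambda1s_bounded : has_ubound lambda1s.
Proof.
(* The constant function 1 bounds every lambda_1, as |1 - s x y| <= 2. *)
pose c : R[i] := (\sum_(x : G) \sum_(y | adj x y) 4) / (#|G|%:R *+ 2).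
have c_real : c \is Num.real.
  apply/ger0_real/divr_ge0; last by rewrite mulrn_wge0.
  by apply: sumr_ge0 => x _; apply: sumr_ge0.
exists (complex.Re c) => r [s sP rP].
rewrite -lecR RRe_real // ler_pdivlMr ?pmulrn_lgt0 ?ltr0n ?vertex_gt0 //.
have norm1 : sqnorm (fun=> 1) = #|G|%:R.
  by rewrite /sqnorm normr1 expr1n sumr_const.
rewrite -norm1 mulrnAr; apply: le_trans (lambda1_le_energy _ sP rP) _.
apply: ler_sum => x _; apply: ler_sum => y xy; rewrite mulr1.
have norm_le2 : `|1 - s x y| <= 2.
  by apply: le_trans (ler_normB _ _) _; rewrite normr1 (sP _ _ xy).1.
by rewrite (_ : 4 = 2 ^+ 2) ?lerXn2r ?nnegrE // -natrX.
Qed.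

Lemma lambda1s_nonempty : (lambda1s !=set0)%classic.
Proof.
have [r rP _] := exists_lambda1 trivial_potential.
by exists r; exists (fun _ _ => 1) => //; apply: trivial_potential.
Qed.

(** The three lemmas that follow, the first two bounding [nu] and the last
    one giving a test function, are all that is used about the spectrum in the
    sequel. *)
Lemma le_nu s (c : R) : magnetic_potential s ->
  (forall f, (c%:C)%C * sqnorm f *+ 2 <= energy s f) -> c <= nu R G.
Proof.
move=> sP c_le; have [r rP _] := exists_lambda1 sP.
have [f f0 fE] := lambda1_attained sP rP.
have := c_le f; rewrite fE lerMn2r /= ler_pM2r // lecR => /le_trans; apply.
by apply: ub_le_sup lambda1s_bounded _ _; exists s.
Qed.

Lemma nu_le (c : R) :
  (forall s, magnetic_potential s ->
     exists2 f, 0 < sqnorm f & energy s f <= (c%:C)%C * sqnorm f *+ 2) ->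
  nu R G <= c.
Proof.
move=> test; apply: ge_sup lambda1s_nonempty _ => r [s sP rP].
have [f f0 fc] := test s sP.
have := le_trans (lambda1_le_energy f sP rP) fc.
by rewrite lerMn2r /= ler_pM2r // lecR.
Qed.

Lemma energy_le_nu s : magnetic_potential s ->
  exists2 f, 0 < sqnorm f & energy s f <= ((nu R G)%:C)%C * sqnorm f *+ 2.
Proof.
move=> sP; have [r rP _] := exists_lambda1 sP.
have [f f0 fE] := lambda1_attained sP rP; exists f => //.
rewrite fE lerMn2r /= ler_pM2r // lecR.
by apply: ub_le_sup lambda1s_bounded _ _; exists s.
Qed.

End Energy.

(** * Suspensions: the upper bound *)

Lemma big_option (V : nmodType) (T : finType) (F : option T -> V) :
  \sum_x F x = F None + \sum_x F (Some x).
Proof.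
rewrite (bigD1 None) //=; congr (_ + _).
rewrite (reindex_omap Some id) /=; last by case.
by apply: eq_bigl => x; rewrite eqxx.
Qed.

(** The hub edges are counted twice with equal values: the two directions
    differ by a factor of modulus 1. *)
Lemma energy_suspension (R : realType) (G : sgraph)
    (s : suspension G -> suspension G -> R[i]) (f : suspension G -> R[i]) :
  magnetic_potential s ->
  energy s f = energy (fun x y : G => s (Some x) (Some y)) (fun x => f (Some x))
    + (\sum_(x : G) `|f None - s None (Some x) * f (Some x)| ^+ 2) *+ 2.
Proof.
move=> sP; rewrite /energy big_option [X in X + _]big_mkcond big_option /=.
have split_nbrs (x : G) : \sum_(y | @adj (suspension G) (Some x) y)
      `|f (Some x) - s (Some x) y * f y| ^+ 2 =
    `|f None - s None (Some x) * f (Some x)| ^+ 2 +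
    \sum_(y | adj x y) `|f (Some x) - s (Some x) (Some y) * f (Some y)| ^+ 2.
  rewrite big_mkcond big_option -big_mkcond /=; congr (_ ^+ 2 + _).
  have [ns _] := sP None (Some x) isT.
  have -> : s (Some x) None = (s None (Some x))^* by apply: (potential_conj sP).
  rewrite -[LHS]mul1r -{1}ns -normrM mulrBr mulrA.
  by rewrite -normCK ns expr1n mul1r distrC.
under [X in _ + X = _]eq_bigr => x _ do rewrite split_nbrs.
by rewrite big_split /= add0r mulr2n addrA addrC.
Qed.

Theorem nu_suspension_le (R : realType) (G : sgraph) :
  nu R (suspension G) <= nu R G + 1.
Proof.
apply: nu_le => s sP.
have resP : magnetic_potential (fun x y : G => s (Some x) (Some y)).
  by move=> x y xy; apply: sP.
have [g g0 gE] := energy_le_nu resP.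
pose f (x : suspension G) := if x is Some u then g u else 0.
have norm_f : sqnorm f = sqnorm g.
  by rewrite /sqnorm big_option /= normr0 expr0n add0r.
exists f; first by rewrite norm_f.
rewrite energy_suspension // norm_f rmorphD rmorph1 mulrDl mul1r mulrnDl.
apply: lerD => //=; rewrite lerMn2r /=; apply: ler_sum => x _.
by rewrite sub0r normrN normrM (sP _ _ _).1 ?mul1r.
Qed.

(** * Star forests *)

(** A star forest is encoded by the map [c] sending each vertex to the centre
    of its star.  Among the idempotent maps with [c x] equal or adjacent to [x],
    take one with the fewest singleton stars.  If [d] were a singleton with
    neighbour [y], the stars could be rearranged to give [y] a star of its own
    that contains [d], without creating another singleton, a contradiction. *)
Lemma star_forest (G : sgraph) : no_isolated G ->
  exists c : G -> G, [/\ forall x, c (c x) = c x,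
    forall x, c x != x -> adj x (c x)
    & forall x, exists2 y, y != x & c y = c x].
Proof.
move=> noiso.
pose P (c : {ffun G -> G}) := [forall x, c (c x) == c x]
  && [forall x, (c x != x) ==> adj x (c x)].
pose lonely (c : {ffun G -> G}) :=
  [set x | [forall y, (c y == c x) ==> (y == x)]].
have lonelyP (c : {ffun G -> G}) x :
    reflect (forall y, c y = c x -> y = x) (x \in lonely c).
  rewrite inE; apply: (iffP forallP) => [lx y /eqP|lx y].
    by move/(implyP (lx y))/eqP.
  by apply/implyP=> /eqP/lx->.
have P_id : P [ffun x => x].
  by apply/andP; split; apply/forallP=> x; rewrite !ffunE eqxx.
case: (arg_minnP (fun c => #|lonely c|) P_id) => c.
case/andP=> /forallP c_idem /forallP c_adj c_min.
have {}c_idem x : c (c x) = c x by apply/eqP.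
have {}c_adj x : c x != x -> adj x (c x) by apply/implyP.
exists c; split=> // d.
have [/lonelyP d_lonely|] := boolP (d \in lonely c); last first.
  rewrite inE negb_forall => /existsP[y]; rewrite negb_imply.
  by case/andP=> /eqP cy yd; exists y.
exfalso; have [y dy] := noiso d.
have yd : y != d by apply: contraTneq dy => ->; rewrite adj_irrefl.
(* A is what the new star of y, apart from d, takes from the old star of y. *)
suff [A [yA AF A_closed A_adj A_rest]] : exists A : {set G},
    [/\ y \in A, forall u, u \in A -> c u = c y, forall u, c u \in A -> u \in A,
      forall u, u \in A -> u != y -> adj u y
      & forall u, u \notin A -> c u = c y ->
          exists u', [/\ u' \notin A, u' != u & c u' = c y]].
  pose c' : {ffun G -> G} :=
    [ffun u => if (u == d) || (u \in A) then y else c u].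
  have c'A u : (u == d) || (u \in A) -> c' u = y by rewrite ffunE => ->.
  have c'C u : u != d -> u \notin A -> c' u = c u.
    by rewrite ffunE => /negPf-> /negPf->.
  have c'y : c' y = y by rewrite c'A // yA orbT.
  have c'd : c' d = y by rewrite c'A // eqxx.
  have c'P : P c'.
    apply/andP; split; apply/forallP=> u.
      have [uA|] := boolP ((u == d) || (u \in A)).
        by rewrite (c'A u) ?c'y.
      rewrite negb_or => /andP[ud uA]; rewrite (c'C u) //.
      rewrite c'C ?c_idem //; last by apply: contraNN uA; apply: A_closed.
      by apply: contraNneq ud => cu; apply/eqP/d_lonely; rewrite -cu c_idem.
    apply/implyP; have [/orP[/eqP->|uA]|] := boolP ((u == d) || (u \in A)).
    - by rewrite c'd.
    - by rewrite c'A ?uA ?orbT // eq_sym => /(A_adj _ uA).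
    - by rewrite negb_or => /andP[ud uA]; rewrite c'C //; apply: c_adj.
  have d_fiber : c d != c y.
    by apply: contraNneq yd => cdy; rewrite (d_lonely y).
  have: (#|lonely c'| < #|lonely c|)%N.
    apply/proper_card/properP; split; last first.
      exists d; first exact/lonelyP.
      by apply: contra yd => /lonelyP/(_ y); rewrite c'y c'd => ->.
    apply/subsetP=> u /lonelyP u_lonely; apply/lonelyP=> v cvu.
    have [ud_uA|] := boolP ((u == d) || (u \in A)).
      have uy : y = u by apply: u_lonely; rewrite c'y c'A.
      have ud : d = u by apply: u_lonely; rewrite c'd c'A.
      by move: yd; rewrite uy ud eqxx.
    rewrite negb_or => /andP[ud uA].
    have u_lonely' w : w != d -> w \notin A -> c w = c u -> w = u.
      by move=> wd wA cwu; apply: u_lonely; rewrite !c'C.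
    have [vd|vd] := eqVneq v d.
      by rewrite vd; apply/esym/d_lonely; rewrite -cvu vd.
    have [vA|vA] := boolP (v \in A); last exact: u_lonely'.
    have [|w [wA wu cw]] := A_rest u uA; first by rewrite -cvu AF.
    case/eqP: wu; apply: u_lonely' => //.
      by apply: contraNneq d_fiber => <-; rewrite cw.
    by rewrite cw -cvu AF.
  by rewrite ltnNge c_min.
(* If the old star has no vertex besides y and its centre, or if y is its
   centre, then all of it is y or adjacent to y: take the whole star.
   Otherwise taking y alone leaves two vertices behind. *)
have [/existsP[w /and3P[/eqP cw wy wcy]]|no_w] :=
  boolP [exists w, [&& c w == c y, w != y & w != c y]]; last first.
  exists [set u | c u == c y]; split; rewrite ?inE //.
  - by move=> u; rewrite inE => /eqP.
  - by move=> u; rewrite !inE c_idem.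
  - move=> u; rewrite inE => /eqP cu uy.
    have ucy : u = c y.
      apply: contraNeq no_w => ucy; apply/existsP; exists u.
      by rewrite cu eqxx uy.
    by rewrite adj_sym ucy c_adj // -ucy.
  - by move=> u; rewrite inE => /eqP.
have [cy|cy] := eqVneq (c y) y.
  exists [set u | c u == c y]; split; rewrite ?inE //.
  - by move=> u; rewrite inE => /eqP.
  - by move=> u; rewrite !inE c_idem.
  - move=> u; rewrite inE => /eqP cu uy; have := c_adj u; rewrite cu cy; apply.
    by rewrite eq_sym.
  - by move=> u; rewrite inE => /eqP.
exists [set y]; split; rewrite ?inE //.
- by move=> u; rewrite inE => /eqP->.
- by move=> u; rewrite !inE => /eqP cu; case/eqP: cy; rewrite -{1}cu c_idem.
- by move=> u; rewrite inE => ->.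
- move=> u uy cu; have [ucy|ucy] := eqVneq u (c y).
    by exists w; rewrite ucy inE.
  by exists (c y); rewrite inE cy eq_sym ucy c_idem.
Qed.

(** * Suspensions: the lower bound *)

(** For a nonempty [A], enumerate it along the powers of a root of
    1 + X + ... + X^(n-1), where n = #|A|.  Such a root exists since n > 1, and
    it is an n-th root of unity. *)
Lemma unit_sum0 (C : numClosedFieldType) (T : finType) (A : {pred T}) :
  #|A| != 1%N ->
  exists2 w : T -> C, forall x, `|w x| = 1 & \sum_(x in A) w x = 0.
Proof.
move=> A1.
have [z z_norm z_sum] : exists2 z : C, `|z| = 1 & \sum_(i < #|A|) z ^+ i = 0.
  have [->|A_gt0] := posnP #|A|; first by exists 1; rewrite ?normr1 ?big_ord0.
  have [|z] := closed_rootP (\poly_(i < #|A|) (1 : C)) _.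
    by rewrite size_poly_eq ?oner_eq0.
  rewrite /root horner_poly => /eqP z_sum.
  rewrite (eq_bigr _ (fun _ _ => mul1r _)) in z_sum.
  exists z => //; apply/eqP; rewrite -(@pexpr_eq1 _ _ #|A|) // -normrX.
  by rewrite -[z ^+ _](subrK 1) subrX1 z_sum mulr0 add0r normr1.
exists (fun x => z ^+ index x (enum A)).
  by move=> x; rewrite normrX z_norm expr1n.
rewrite big_enum_val -[RHS]z_sum; apply: eq_bigr => i _.
by rewrite (enum_val_nth (enum_default i)) index_uniq ?enum_uniq // -cardE.
Qed.

(** A leaf is not a centre, so the pairs (x, c x) and (c x, x) with [x] a leaf
    are all distinct. *)
Lemma star_energy_le (R : realType) (G : sgraph) (c : G -> G) (g : G -> R[i]) :
  (forall x, c (c x) = c x) -> (forall x, c x != x -> adj x (c x)) ->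
  (\sum_x `|g (c x) - g x| ^+ 2) *+ 2 <= energy (fun _ _ => 1) g.
Proof.
move=> c_idem c_adj; pose D x y := `|g x - g y| ^+ 2.
have D_ge0 x y : 0 <= D x y by rewrite exprn_ge0.
have sum_c : \sum_x `|g (c x) - g x| ^+ 2 =
    \sum_x \sum_y (if y == c x then D x y else 0).
  by apply: eq_bigr => x _; rewrite -big_mkcond big_pred1_eq /D distrC.
have sum_c' : \sum_x `|g (c x) - g x| ^+ 2 =
    \sum_x \sum_y (if x == c y then D x y else 0).
  rewrite exchange_big; apply: eq_bigr => x _.
  by rewrite -big_mkcond big_pred1_eq.
rewrite mulr2n {1}sum_c sum_c' -big_split; apply: ler_sum => x _.
rewrite -big_split [leRHS]big_mkcond; apply: ler_sum => y _ /=.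
rewrite mul1r -/(D x y).
have [->|xy] := eqVneq x y.
  by rewrite /D subrr normr0 expr0n !if_same addr0.
have [yc|yc] := eqVneq y (c x).
  rewrite yc c_idem -yc (negPf xy) addr0 ifT // yc c_adj // -yc.
  by rewrite eq_sym.
rewrite add0r; have [xc|_] := eqVneq x (c y); last by case: ifP.
by rewrite ifT // adj_sym xc c_adj // -xc.
Qed.

(** The difference of the two sides is the square of the distance from [a] to
    its optimal value w^* h + b. *)
Lemma star_square_bound (C : numClosedFieldType) (w h a b : C) : `|w| = 1 ->
  `|a| ^+ 2 - ((w^* * h * b^*) + (w^* * h * b^*)^*) <=
  `|h - w * a| ^+ 2 + `|b - a| ^+ 2.
Proof.
move=> w1; have ww : w * w^* = 1 by rewrite -normCK w1 expr1n.
rewrite -subr_ge0; suff -> : `|h - w * a| ^+ 2 + `|b - a| ^+ 2 -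
    (`|a| ^+ 2 - ((w^* * h * b^*) + (w^* * h * b^*)^*)) =
    `|a - (w^* * h + b)| ^+ 2 by rewrite exprn_ge0.
rewrite !normCK !rmorphB !rmorphD !rmorphM /= !conjCK.
(* Isolate the factors w w^* on both sides to replace them by 1. *)
transitivity (h * h^* - h * w^* * a^* - w * a * h^* + w * w^* * (a * a^*)
    + (b - a) * (b^* - a^*) - (a * a^* - (w^* * h * b^* + w * h^* * b))).
  by ring.
transitivity (a * a^* - a * (w * h^* + b^*) - (w^* * h + b) * a^*
    + (w * w^* * (h * h^*) + w^* * h * b^* + b * w * h^* + b * b^*)).
  by rewrite ww; ring.
by ring.
Qed.

Lemma sqr_normB (C : numClosedFieldType) (u v : C) :
  `|u - v| ^+ 2 = `|u| ^+ 2 + `|v| ^+ 2 - (u * v^* + (u * v^*)^*).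
Proof. by rewrite !normCK rmorphB rmorphM /= conjCK; ring. Qed.

Lemma center_square (C : numClosedFieldType) (w h a : C) : `|w| = 1 ->
  `|h - w * a| ^+ 2 =
  `|a| ^+ 2 + `|h| ^+ 2 - ((w^* * h * a^*) + (w^* * h * a^*)^*).
Proof.
move=> w1; rewrite sqr_normB normrM w1 mul1r [_ + `|a| ^+ 2]addrC.
congr (_ - _).
by rewrite !rmorphM /= conjCK; ring.
Qed.

Theorem one_le_nu_suspension (R : realType) (G : sgraph) :
  no_isolated G -> 1 <= nu R (suspension G).
Proof.
move=> /star_forest[c [c_idem c_adj c_fiber]].
have /boolp.choice[W W_P] : forall d, exists w : G -> R[i],
    (forall x, `|w x| = 1) /\ \sum_(x | c x == d) w x = 0.
  move=> d; have [|w w1 w0] := @unit_sum0 R[i] G [pred x | c x == d].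
    have [x xd|no_x] := pickP [pred x | c x == d]; last by rewrite eq_card0.
    have [y yx cyx] := c_fiber x.
    rewrite gtn_eqF //; apply/card_gt1P; exists x, y; split=> //.
      by rewrite inE cyx.
    by rewrite eq_sym.
  by exists w.
pose w x := W (c x) x.
have w1 x : `|w x| = 1 by apply: (W_P _).1.
have w0 d : \sum_(x | c x == d) w x = 0.
  by rewrite -[RHS](W_P d).2; apply: eq_bigr => x /eqP cx; rewrite /w cx.
pose s (u v : suspension G) : R[i] :=
  match u, v with
  | None, Some x => w x
  | Some x, None => (w x)^-1
  | _, _ => 1
  end.
have sP : magnetic_potential s.
  case=> [x|] [y|] _ //=; rewrite ?normrV ?unitfE ?w1 ?normr1 ?invr1 ?invrK //.
  by rewrite -normr_eq0 w1 oner_eq0.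
apply: (le_nu sP) => f; rewrite rmorph1 mul1r energy_suspension //=.
set h := f None; pose g x := f (Some x).
apply: le_trans (lerD (star_energy_le g c_idem c_adj) (lexx _)).
rewrite -mulrnDl lerMn2r /= /sqnorm big_option -/h -big_split /=.
pose q x := (w x)^* * h * (g (c x))^*.
have sum_q : \sum_x q x = 0.
  rewrite (partition_big c predT) //= big1 // => d _.
  rewrite (eq_bigr (fun x => (w x)^* * (h * (g d)^*))) => [|x /eqP cx].
    by rewrite -mulr_suml -rmorph_sum w0 rmorph0 mul0r.
  by rewrite /q cx mulrA.
have term_bound x :
    `|g x| ^+ 2 + (if c x == x then `|h| ^+ 2 else 0) - (q x + (q x)^*) <=
    `|g (c x) - g x| ^+ 2 + `|h - w x * g x| ^+ 2.
  case: eqP => [cx|_].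
    by rewrite /q cx subrr normr0 expr0n add0r center_square.
  by rewrite addr0 [leRHS]addrC star_square_bound.
apply: le_trans (ler_sum _ (fun x _ => term_bound x)).
rewrite sumrB !big_split /= -rmorph_sum sum_q rmorph0 addr0 subr0 addrC lerD2l.
have /card_gt0P[x0 _] := vertex_gt0 G.
rewrite (bigD1 (c x0)) //= c_idem eqxx lerDl; apply: sumr_ge0 => x _.
by case: ifP; rewrite ?exprn_ge0.
Qed.

(** * Trees *)

Lemma tree_no_isolated (T : sgraph) :
  is_tree T -> (2 <= #|T|)%N -> no_isolated T.
Proof.
move=> [conn _] /card_gt1P[a [b [_ _ ab]]] x.
have [z zx] : exists z, z != x.
  have [ax|ax] := eqVneq a x; last by exists a.
  by exists b; rewrite -ax eq_sym.
have /connectP[[|y p] /= xp zE] := conn x z; first by rewrite zE eqxx in zx.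
by exists y; case/andP: xp.
Qed.

(** A walk from [y] to [y'] in [S] avoids [x]; made simple, it would close to
    a cycle through [x] if [y] and [y'] were distinct. *)
Lemma tree_unique_neighbour (T : sgraph) (S : {set T}) (x y y' : T) :
  acyclic T -> x \notin S -> y \in S ->
  connect [rel u v | [&& adj u v, u \in S & v \in S]] y y' ->
  adj x y -> adj x y' -> y' = y.
Proof.
move=> acyc xS yS /connectP[p0 p0P y'E] xy xy'.
move: y'E; case/shortenP: p0P => p pP p_uniq _ y'E.
apply/eqP/negP=> /negP y'y.
have pS : all (mem S) p.
  elim: p y {yS xy y'y p_uniq y'E} pP => //= z p IH y /andP[/and3P[_ _ zS]] zp.
  by rewrite zS (IH z).
apply: (acyc [:: x, y & p]).
  by case: p {pP p_uniq pS} y'E y'y => //= ->; rewrite eqxx.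
apply/andP; split; last first.
  rewrite cons_uniq p_uniq andbT inE negb_or; apply/andP; split.
    by apply: contraNneq xS => ->.
  by apply: contraNN xS => /(allP pS).
rewrite /= xy rcons_path -y'E adj_sym xy' andbT.
by apply: sub_path pP => u v /and3P[].
Qed.

(** The function is built on a connected set of vertices that grows by one
    neighbour [x] at a time; [x] has a single neighbour in the set, so only one
    edge condition is added and it can be met by the choice of the value at
    [x]. *)
Lemma tree_gauge (R : realType) (T : sgraph) (s : T -> T -> R[i]) :
  is_tree T -> magnetic_potential s ->
  exists2 f : T -> R[i], forall x, f x != 0 &
    forall x y, adj x y -> f x = s x y * f y.
Proof.
move=> [conn acyc] sP.
pose inS (S : {set T}) := [rel u v | [&& adj u v, u \in S & v \in S]].
pose gauged (S : {set T}) := exists2 f : T -> R[i], forall x, f x != 0 &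
  forall x y, x \in S -> y \in S -> adj x y -> f x = s x y * f y.
have /card_gt0P[x0 _] := vertex_gt0 T.
suff grow n : (0 < n <= #|T|)%N -> exists S : {set T},
    [/\ #|S| = n, gauged S & {in S &, forall x y, connect (inS S) x y}].
  have [|S [ST [f f0 fE] _]] := grow #|T|; first by rewrite vertex_gt0 leqnn.
  have S_full x : x \in S.
    suff -> : S = setT by rewrite inE.
    by apply/eqP; rewrite eqEcard subsetT cardsT ST leqnn.
  by exists f => // x y; apply: fE.
case: n => // n; elim: n => [|n IH] n_le.
  exists [set x0]; split; first by rewrite cards1.
    exists (fun=> 1); first by move=> ?; rewrite oner_eq0.
    by move=> x y /set1P-> /set1P->; rewrite adj_irrefl.
  by move=> x y /set1P-> /set1P->; apply: connect0.
have [|S [Sn [f f0 fE] S_conn]] := IH; first exact: ltnW.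
have [[y x] /and3P[/= yx yS xS]|no_edge] :=
  pickP (fun e : T * T => [&& adj e.1 e.2, e.1 \in S & e.2 \notin S]);
  last first.
  have [z zS] : exists z, z \in S by apply/card_gt0P; rewrite Sn.
  have S_closed : closed (@adj T) S.
    move=> u v uv; apply/idP/idP => [uS|vS].
      by have := no_edge (u, v); rewrite /= uv uS => /negbFE.
    by have := no_edge (v, u); rewrite /= adj_sym uv vS => /negbFE.
  have S_full : S = setT.
    by apply/setP=> u; rewrite inE -(closed_connect S_closed (conn z u)).
  by move: n_le; rewrite -Sn S_full cardsT ltnn.
have only_y y' : y' \in S -> adj x y' -> y' = y.
  move=> y'S xy'; apply: (tree_unique_neighbour acyc xS yS) xy' => //.
    exact: S_conn.
  by rewrite adj_sym.
have sxy : s x y != 0 by rewrite -normr_eq0 (sP x y _).1 ?oner_eq0 // adj_sym.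
exists (x |: S); split; first by rewrite cardsU1 xS Sn.
  exists (fun u => if u == x then s x y * f y else f u).
    by move=> u; case: ifP => _ //; rewrite mulf_neq0.
  move=> u v; rewrite !inE.
  have [->|ux] := eqVneq u x; have [->|vx] := eqVneq v x => //=.
  - by rewrite adj_irrefl.
  - by move=> _ vS xv; rewrite (only_y v vS xv).
  - move=> uS _ ux'; have uy : u = y by apply: only_y => //; rewrite adj_sym.
    have [_ ->] : _ /\ s u x = _ := sP x u (etrans (adj_sym _ _) ux').
    by rewrite uy mulKf.
  - by move=> uS vS; apply: fE.
have S_sub u v : connect (inS S) u v -> connect (inS (x |: S)) u v.
  apply: connect_sub => a b /and3P[ab aS bS]; apply: connect1.
  by rewrite /= ab !inE aS bS !orbT.
have xy_conn : connect (inS (x |: S)) x y /\ connect (inS (x |: S)) y x.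
  by split; apply: connect1; rewrite /= ?yx 1?adj_sym ?yx !inE eqxx yS orbT.
move=> u v /setU1P[->|uS] /setU1P[->|vS].
- exact: connect0.
- exact: connect_trans xy_conn.1 (S_sub _ _ (S_conn _ _ yS vS)).
- exact: connect_trans (S_sub _ _ (S_conn _ _ uS yS)) xy_conn.2.
- exact/S_sub/S_conn.
Qed.

Theorem nu_tree_le0 (R : realType) (T : sgraph) : is_tree T -> nu R T <= 0.
Proof.
move=> T_tree; apply: nu_le => s sP.
have [f f0 fE] := tree_gauge T_tree sP; exists f.
  by have /card_gt0P[x _] := vertex_gt0 T; apply: sqnorm_gt0 (f0 x).
rewrite rmorph0 mul0r mul0rn; apply: sumr_le0 => x _; apply: sumr_le0 => y xy.
by rewrite -fE // subrr normr0 expr0n.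
Qed.

Theorem theorem4p11 (R : realType) :
  (forall G : sgraph, no_isolated G ->
     1 <= nu R (suspension G) /\ nu R (suspension G) <= nu R G + 1) /\
  (forall T : sgraph, is_tree T -> (2 <= #|T|)%N -> nu R (suspension T) = 1).
Proof.
split=> [G G_noiso|T T_tree T_ge2].
  by split; [apply: one_le_nu_suspension | apply: nu_suspension_le].
apply/eqP; rewrite eq_le one_le_nu_suspension ?andbT; last first.
  exact: tree_no_isolated.
apply: le_trans (nu_suspension_le R T) _.
by rewrite gerDr nu_tree_le0.
Qed.
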